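(* Let $T>0$. Consider the controlled stochastic system $d\boldsymbol{x}_t=(f(\boldsymbol{x}_t)+g(\boldsymbol{x}_t)\boldsymbol{u}_t)\,dt+\sigma(\boldsymbol{x}_t)\,d\boldsymbol{w}_t$ and the safe set $S=\{\boldsymbol{x}\in\mathbb{R}^n:0\le B(\boldsymbol{x})<1\}$ defined by a twice continuously differentiable, positive semi-definite function $B:\mathbb{R}^n\to\mathbb{R}$ with $B\le\gamma$ on the set of initial states $\mathcal{X}_0$, $\gamma\in[0,1]$. Suppose that $B$ is a stochastic control barrier function on $S$ with constants $\alpha,\beta\ge0$, and let $\rho_{S\text{-}CBF}$ denote the corresponding risk bound $$\rho_{S\text{-}CBF}=\begin{cases}1-(1-\gamma)e^{-\beta T}, & \alpha>0 \text{ and } \alpha\ge\beta,\\ \left(\gamma+(e^{\beta T}-1)\frac{\beta}{\alpha}\right)e^{-\beta T}, & \alpha>0\text{ and }\alpha<\beta,\\ \gamma+\beta T, & \alpha=0.\end{cases}$$ Let $\eta=\sup_{\boldsymbol{x}\in S}\|L_\sigma B(\boldsymbol{x})\|$ and $\mathcal{R}=\left[1-\mathrm{erf}\left(\frac{1-\gamma}{\sqrt{2}\,\eta T}\right),1\right]$, the admissible range of the risk design parameter $\rho_d$ of a risk-aware control barrier function. If $B$ is a risk-aware control barrier function on $S$, then $$\min_{\rho_d\in\mathcal{R}}\rho_d<\rho_{S\text{-}CBF}$$ whenever $$\eta<\frac{1-\gamma}{\sqrt{2}\,T\,\mathrm{erf}^{-1}(1-\gamma)}.$$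
   Context: System: $\boldsymbol{x}\in\mathcal{X}\subseteq\mathbb{R}^n$ is the state, $\boldsymbol{u}\in\mathcal{U}\subseteq\mathbb{R}^m$ the control input, $\boldsymbol{w}$ a standard $q$-dimensional Wiener process on a complete probability space $(\Omega,\mathcal{F},P)$. The set $\mathcal{X}$ is bounded. The control is a state feedback $\boldsymbol{u}_t=k(\boldsymbol{x}_t)$. The functions $f:\mathcal{X}\to\mathbb{R}^n$, $g:\mathcal{X}\to\mathbb{R}^{n\times m}$, $k:\mathcal{X}\to\mathcal{U}$ and $\sigma:\mathbb{R}^n\to\mathbb{R}^{n\times q}$ are known, locally Lipschitz and bounded on $\mathcal{X}$, and for all $\boldsymbol{x}_0\in\mathcal{X}_0\subset\mathbb{R}^n$ the process $\{\boldsymbol{x}_t:t\in[0,\infty)\}$ is assumed to be a strong solution of the SDE. Safe set and initial set: $B:\mathbb{R}^n\to\mathbb{R}$ is twice continuously differentiable and positive semi-definite, $S=\{\boldsymbol{x}\in\mathbb{R}^n:0\le B(\boldsymbol{x})<1\}$, and $B(\boldsymbol{x})\le\gamma$ for all $\boldsymbol{x}\in\mathcal{X}_0$, for some $\gamma\in[0,1]$. Stopped process: if $\tau>0$ is the first exit time of $\boldsymbol{x}_t$ from $S$, then $\tilde{\boldsymbol{x}}_t=\boldsymbol{x}_t$ for $t<\tau$ and $\tilde{\boldsymbol{x}}_t=\boldsymbol{x}_\tau$ for $t\ge\tau$. Notation: $L_f\phi(\boldsymbol{x})=\frac{\partial\phi}{\partial\boldsymbol{x}}f(\boldsymbol{x})$,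 and similarly $L_g\phi=\frac{\partial\phi}{\partial\boldsymbol{x}}g$, $L_\sigma\phi=\frac{\partial\phi}{\partial\boldsymbol{x}}\sigma$. The generator applied to $B$ is $$\Gamma_B(\boldsymbol{x},\boldsymbol{u})=L_fB(\boldsymbol{x})+L_gB(\boldsymbol{x})\boldsymbol{u}+\tfrac12\mathrm{Tr}\left(\sigma(\boldsymbol{x})^T\frac{\partial^2B}{\partial\boldsymbol{x}^2}\sigma(\boldsymbol{x})\right).$$ $\mathrm{erf}(z)=\frac{2}{\sqrt{\pi}}\int_0^ze^{-t^2}dt$, and $\mathrm{erf}^{-1}$ is its inverse. $\mathcal{K}_\infty$ denotes the class of continuous, strictly increasing, unbounded functions on $[0,\infty)$ vanishing at $0$. Stochastic control barrier function (S-CBF): $B$ is an S-CBF on $S$ if there exist constants $\alpha,\beta\ge0$ such that $\inf_{\boldsymbol{u}\in\mathcal{U}}\Gamma_B(\boldsymbol{x},\boldsymbol{u})\le-\alpha B(\boldsymbol{x})+\beta$ for all $\boldsymbol{x}\in S$. The number called $\rho_{S\text{-}CBF}$ in the claim is the known upper bound, for an S-CBF with these constants, on the probability that $\tilde{\boldsymbol{x}}_t$ exits $S$ during $[0,T]$ given $\tilde{\boldsymbol{x}}_0\in\mathcal{X}_0$. Risk-aware control barrier function (RA-CBF): with $I_L(t)=\int_0^t\Gamma_B(\tilde{\boldsymbol{x}}_s,\boldsymbol{u}_s)\,ds$, $B$ is an RA-CBF on $S$ if there exists a Lipschitz continuous $\hat\alpha\in\mathcal{K}_\infty$ such that for all $\boldsymbol{x}\in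 S$, $\inf_{\boldsymbol{u}\in\mathcal{U}}\Gamma_B(\boldsymbol{x},\boldsymbol{u})\le\hat\alpha\big(h(I_L(t))\big)$, where $h(I_L(t))=1-\gamma-(\sqrt{2}\,\eta T)\,\mathrm{erf}^{-1}(1-\rho_d)-I_L(t)$, $\rho_d\in\mathcal{R}$ is a design parameter, and $\eta=\sup_{\boldsymbol{x}\in S}\|L_\sigma B(\boldsymbol{x})\|$. *)

(* Defs.v *)
From HB Require Import structures.
From mathcomp Require Export all_boot all_order all_algebra.
From mathcomp Require Export all_classical all_reals all_analysis.

Set Implicit Arguments.
Unset Strict Implicit.
Unset Printing Implicit Defensive.

Export Order.TTheory GRing.Theory Num.Theory.
Export numFieldNormedType.Exports.

#[global] Open Scope classical_set_scope.
#[global] Open Scope ring_scope.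

(* R^p is the type of column vectors ['cV[R]_p]. Its library norm is the sup
   norm, so the Euclidean norm is defined explicitly; boundedness, continuity
   and (local) Lipschitz continuity do not depend on this choice. *)
Definition euclidean_norm (R : realType) (p : nat) (v : 'rV[R]_p) : R :=
  Num.sqrt (\sum_(j < p) v 0 j ^+ 2).

Definition locally_lipschitz (R : realType) (V W : normedModType R)
    (A : set V) (F : V -> W) : Prop :=
  forall x, A x ->
    exists2 N : set V, nbhs x N & [lipschitz F y | y in A `&` N].

(* Class K_infinity; only the values on [0, +oo[ matter. *)
Definition class_Kinfty (R : realType) (a : R -> R) : Prop :=
  [/\ {within `[0, +oo[, continuous a},
      {in `[0, +oo[ &, {homo a : s t / s < t}},
      a 0 = 0
    & forall M : R, exists2 s, 0 <= s & M < a s].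

Section error_function.
Variable R : realType.

(* erf on the extended line, with its limits -1 and 1 at -oo and +oo. *)
Definition erf (z : \bar R) : R :=
  match z with
  | r%:E => 2 / Num.sqrt pi *
      (if 0 <= r then \int[lebesgue_measure]_(t in `[0, r]) expR (- t ^+ 2)
       else - \int[lebesgue_measure]_(t in `[r, 0]) expR (- t ^+ 2))
  | +oo%E => 1
  | -oo%E => - 1
  end.

(* The inverse of erf, from [-1, 1] to the extended line; the default value
   is never used there since erf is a bijection. *)
Definition erf_inv (p : R) : \bar R := xget 0%E [set z | erf z = p].

End error_function.

Section calculus.
Variables (R : realType) (n : nat).
Implicit Types (B : 'cV[R]_n -> R) (x : 'cV[R]_n).

Definition partial B (i : 'I_n) : 'cV[R]_n -> R :=
  fun x => 'D_(delta_mx i 0) B x.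

Definition C2 B : Prop :=
  [/\ continuous B,
      forall i, (forall x, derivable B x (delta_mx i 0)) /\
                continuous (partial B i)
    & forall i j, (forall x, derivable (partial B i) x (delta_mx j 0)) /\
                  continuous (partial (partial B i) j)].

Definition gradient B x : 'rV[R]_n := \row_i partial B i x.

Definition hessian B x : 'M[R]_n := \matrix_(i, j) partial (partial B i) j x.

Definition lie (p : nat) (F : 'cV[R]_n -> 'M[R]_(n, p)) B x : 'rV[R]_p :=
  gradient B x *m F x.

End calculus.

Section stochastic_calculus.
Variables (R : realType) (d : measure_display) (Omega : measurableType d).
Variable P : probability Omega R.

(* The natural filtration of w, augmented with the P-null sets. *)
Definition wiener_filtration (q : nat) (w : R -> Omega -> 'cV[R]_q) (t : R) :
    set (set Omega) :=
  <<s [set A | P.-negligible A \/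
       exists (s : R) (i : 'I_q) (E : set R),
         [/\ 0 <= s <= t, measurable E & A = [set o | E (w s o i 0)]]] >>.

(* On the complete space (Omega, P): increments w_t - w_s are independent of
   the past up to s and have law N(0, (t - s) I_q). The second argument of
   [normal_prob] is the standard deviation. *)
Definition standard_wiener (q : nat) (w : R -> Omega -> 'cV[R]_q) : Prop :=
  [/\ forall t i, 0 <= t -> measurable_fun setT (fun o => w t o i 0),
      {ae P, forall o, w 0 o = 0},
      {ae P, forall o, {within `[0, +oo[, continuous (fun t => w t o)}}
    & forall (s t : R) (A : set Omega) (E : 'I_q -> set R),
        0 <= s < t -> wiener_filtration w s A ->
        (forall i, measurable (E i)) ->
        P (A `&` [set o | forall i, E i (w t o i 0 - w s o i 0)]) =
        (P A * \prod_(i < q) normal_prob 0 (Num.sqrt (t - s)) (E i))%E].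

(* The process sum_(k < sp_size) sp_val k * 1_[sp_time k, sp_time k.+1[. *)
Record simple_process := SimpleProcess {
  sp_size : nat;
  sp_time : nat -> R;
  sp_val : nat -> Omega -> R }.

Definition sp_eval (e : simple_process) (s : R) (o : Omega) : R :=
  \sum_(k < sp_size e)
    sp_val e k o * \1_(`[sp_time e k, sp_time e k.+1[%classic) s.

Definition sp_integral (e : simple_process) (b : R -> Omega -> R)
    (o : Omega) : R :=
  \sum_(k < sp_size e)
    sp_val e k o * (b (sp_time e k.+1) o - b (sp_time e k) o).

Definition sp_adapted (F : R -> set (set Omega)) (t : R)
    (e : simple_process) : Prop :=
  [/\ sp_time e 0 = 0,
      sp_time e (sp_size e) = t,
      forall k, (k < sp_size e)%N -> sp_time e k <= sp_time e k.+1
    & forall k, (k < sp_size e)%N ->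
        (exists M : R, forall o, `|sp_val e k o| <= M) /\
        (forall E : set R, measurable E ->
           F (sp_time e k) (sp_val e k @^-1` E))].

(* Y is the Ito integral of H against b over [0, t]: the L^2 limit of the
   integrals of adapted simple processes converging to H in
   L^2([0, t] x Omega). *)
Definition is_ito_integral (F : R -> set (set Omega)) (b : R -> Omega -> R)
    (t : R) (H : R -> Omega -> R) (Y : Omega -> R) : Prop :=
  measurable_fun setT Y /\
  exists e : nat -> simple_process,
    [/\ forall l, sp_adapted F t (e l),
        (\int[P]_o \int[lebesgue_measure]_(s in `[0%R, t])
           ((sp_eval (e l) s o - H s o) ^+ 2)%:E)%E @[l --> \oo] --> 0%E
      & (\int[P]_o ((sp_integral (e l) b o - Y o) ^+ 2)%:E)%E
          @[l --> \oo] --> 0%E].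

(* Strong solution, started at x0 and with values in X, of
     dx = (f x + g x * k x) dt + sigma x dw. *)
Definition strong_solution (n m q : nat) (w : R -> Omega -> 'cV[R]_q)
    (X : set 'cV[R]_n) (f : 'cV[R]_n -> 'cV[R]_n)
    (g : 'cV[R]_n -> 'M[R]_(n, m)) (k : 'cV[R]_n -> 'cV[R]_m)
    (sigma : 'cV[R]_n -> 'M[R]_(n, q))
    (x0 : 'cV[R]_n) (x : R -> Omega -> 'cV[R]_n) : Prop :=
  [/\ forall (t : R) i (E : set R), 0 <= t -> measurable E ->
        wiener_filtration w t [set o | E (x t o i 0)],
      {ae P, forall o, {within `[0, +oo[, continuous (fun t => x t o)}},
      {ae P, forall o, forall t : R, 0 <= t -> X (x t o)}
    & forall (t : R) i, 0 <= t ->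
        exists2 Y : 'I_q -> Omega -> R,
          (forall j, is_ito_integral (wiener_filtration w)
             (fun s o => w s o j 0) t (fun s o => sigma (x s o) i j) (Y j))
        & {ae P, forall o,
             x t o i 0 = x0 i 0
               + \int[lebesgue_measure]_(s in `[0, t])
                   (f (x s o) + g (x s o) *m k (x s o)) i 0
               + \sum_(j < q) Y j o}].

End stochastic_calculus.

Section barrier_functions.
Variables (R : realType) (n m q : nat).
Variables (f : 'cV[R]_n -> 'cV[R]_n) (g : 'cV[R]_n -> 'M[R]_(n, m)).
Variables (k : 'cV[R]_n -> 'cV[R]_m) (sigma : 'cV[R]_n -> 'M[R]_(n, q)).
Variable B : 'cV[R]_n -> R.

Definition safe_set : set 'cV[R]_n := [set x | 0 <= B x < 1].

Definition generator (x : 'cV[R]_n) (u : 'cV[R]_m) : R :=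
  lie f B x 0 0 + (lie g B x *m u) 0 0
  + 2^-1 * \tr ((sigma x)^T *m hessian B x *m sigma x).

Definition inf_generator (U : set 'cV[R]_m) (x : 'cV[R]_n) : \bar R :=
  ereal_inf [set (generator x u)%:E | u in U].

Definition is_SCBF (U : set 'cV[R]_m) (alpha beta : R) : Prop :=
  [/\ 0 <= alpha, 0 <= beta
    & forall x, safe_set x ->
        (inf_generator U x <= (- alpha * B x + beta)%:E)%E].

(* Supremum in [0, +oo], hence 0 when the safe set is empty. *)
Definition eta : \bar R :=
  maxe 0%E
    (ereal_sup [set (euclidean_norm (lie sigma B x))%:E | x in safe_set]).

(* Extended-real division: if eta = 0 the quotient is +oo for gamma < 1 and
   0 for gamma = 1. *)
Definition admissible_risks (gamma T : R) : set R :=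
  `[1 - erf ((1 - gamma)%:E / ((Num.sqrt 2)%:E * eta * T%:E))%E, 1]%classic.

Section paths.
Variable Omega : Type.
Variable x : R -> Omega -> 'cV[R]_n.

Definition exit_time (o : Omega) : \bar R :=
  ereal_inf [set t%:E | t in [set t : R | 0 <= t /\ ~ safe_set (x t o)]].

Definition stopped (t : R) (o : Omega) : 'cV[R]_n :=
  if (t%:E < exit_time o)%E then x t o else x (fine (exit_time o)) o.

Definition I_L (t : R) (o : Omega) : R :=
  \int[lebesgue_measure]_(s in `[0, t]) generator (stopped s o) (k (x s o)).

Definition risk_margin (gamma T rho_d t : R) (o : Omega) : \bar R :=
  ((1 - gamma)%:E - (Num.sqrt 2)%:E * eta * T%:E * erf_inv (1 - rho_d)
   - (I_L t o)%:E)%E.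

End paths.

(* [x x0] is the solution started at x0. The inequality is imposed almost
   surely, at all times of the horizon [0, T] at which the margin lies in the
   domain [0, +oo[ of ahat. *)
Definition is_RACBF (d : measure_display) (Omega : measurableType d)
    (P : probability Omega R) (U : set 'cV[R]_m) (X0 : set 'cV[R]_n)
    (x : 'cV[R]_n -> R -> Omega -> 'cV[R]_n) (gamma T rho_d : R) : Prop :=
  exists ahat : R -> R,
    [/\ class_Kinfty ahat,
        [lipschitz ahat s | s in `[0, +oo[%classic]
      & forall x0, X0 x0 ->
          {ae P, forall o, forall (t : R) z,
             0 <= t <= T -> safe_set z ->
             (0 <= risk_margin (x x0) gamma T rho_d t o)%E ->
             (inf_generator U z <=
              (ahat (fine (risk_margin (x x0) gamma T rho_d t o)))%:E)%E}].

End barrier_functions.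

Definition rho_SCBF (R : realType) (gamma T alpha beta : R) : R :=
  if 0 < alpha then
    if beta <= alpha then 1 - (1 - gamma) * expR (- (beta * T))
    else (gamma + (expR (beta * T) - 1) * (beta / alpha)) * expR (- (beta * T))
  else gamma + beta * T.

(* Main.v *)
(* The three cases of the bound give rho_SCBF >= gamma, while the least
   admissible risk is 1 - erf ((1 - gamma) / (sqrt 2 * eta * T)). Since erf is
   strictly increasing on [0, +oo] and onto [0, 1] (Gauss integral and
   intermediate value theorem), the bound on eta says that
   erf^-1 (1 - gamma) < (1 - gamma) / (sqrt 2 * eta * T), hence the least
   admissible risk is smaller than gamma. *)

Require Import Defs.
From mathcomp Require Import ring lra.

Set Implicit Arguments.
Unset Strict Implicit.
Unset Printing Implicit Defensive.

Section erf_theory.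
Variable R : realType.
Implicit Types a b r p : R.

Local Notation mu := (@lebesgue_measure R).
Local Notation gauss_int := (@gauss_integral_proof.integral0_gauss R).

Lemma integrable_gauss_fun (D : set R) : measurable D ->
  mu.-integrable D (EFin \o gauss_fun).
Proof. by move=> mD; exact: integrableS (@integrableT_gauss R). Qed.

Lemma Rintegral_gauss_fun_gt0 a b : a < b ->
  0 < \int[mu]_(t in `[a, b]) gauss_fun t.
Proof.
(* On [[a, b]] one has [t ^+ 2 <= a ^+ 2 + b ^+ 2], whatever the signs of [a] and [b], so the
   positive constant [c] bounds the integrand from below. *)
move=> ab; pose c := expR (- (a ^+ 2 + b ^+ 2)).
apply: (@lt_le_trans _ _ (\int[mu]_(t in `[a, b]) cst c t)).
  rewrite Rintegral_cst//= lebesgue_measure_itv/= lte_fin ab.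
  by rewrite mulr_gt0 ?expR_gt0// subr_gt0.
apply: le_Rintegral => //.
- apply: continuous_compact_integrable; first exact: segment_compact.
  by apply: continuous_subspaceT => ?; exact: cvg_cst.
- exact: integrable_gauss_fun.
- move=> t; rewrite /= in_itv/= => /andP[at_ tb].
  rewrite /c /gauss_fun ler_expR lerN2.
  by have [t0|t0] := leP 0 t; nra.
Qed.

Lemma lt_integral0_gauss a b : 0 <= a -> a < b -> gauss_int a < gauss_int b.
Proof.
move=> a0 ab; rewrite -subr_gt0 /gauss_integral_proof.integral0_gauss.
rewrite (Rintegral_itvB (integrable_gauss_fun _)) ?bnd_simp ?(ltW ab)//.
rewrite Rintegral_itv_obnd_cbnd; last exact: integrable_gauss_fun.
exact: Rintegral_gauss_fun_gt0.
Qed.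

(** The Gauss integral is known through the limit [pi / 4] of the square; nonnegativity of the
    integral allows taking the square root. *)
Lemma cvg_integral0_gauss : gauss_int r @[r --> +oo] --> Num.sqrt pi / 2.
Proof.
have -> : gauss_int = Num.sqrt \o (fun r => gauss_int r ^+ 2).
  apply/funext => r /=; rewrite sqrtr_sqr ger0_norm//.
  exact: gauss_integral_proof.integral0_gauss_ge0.
have -> : Num.sqrt pi / 2 = Num.sqrt (pi / 4) :> R.
  by rewrite sqrtrM ?pi_ge0// sqrtrV// (_ : 4 = 2 ^+ 2) ?sqrtr_sqr ?ger0_norm//
    expr2 -natrM.
apply: continuous_cvg; first exact: sqrt_continuous.
exact: gauss_integral_proof.cvg_integral0_gauss_sqr.
Qed.

Lemma erf_ge0E r : 0 <= r -> erf r%:E = 2 / Num.sqrt pi * gauss_int r.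
Proof. by move=> r0; rewrite /erf r0. Qed.

Let sqrt_pi_gt0 : 0 < 2 / Num.sqrt pi :> R.
Proof. by rewrite divr_gt0// sqrtr_gt0 pi_gt0. Qed.

Lemma cvg_erf : erf r%:E @[r --> +oo] --> (1 : R).
Proof.
have : 2 / Num.sqrt pi * gauss_int r @[r --> +oo]
    --> 2 / Num.sqrt pi * (Num.sqrt pi / 2).
  by apply: cvgMl_tmp; exact: cvg_integral0_gauss.
have -> : 2 / Num.sqrt pi * (Num.sqrt pi / 2) = 1 :> R.
  by rewrite mulrA divfK ?divff// gt_eqF// sqrtr_gt0 pi_gt0.
apply: cvg_trans; apply: near_eq_cvg.
by near=> r; rewrite erf_ge0E.
Unshelve. all: end_near. Qed.

Lemma erf_EFin_lt a b : 0 <= a -> a < b -> erf a%:E < erf b%:E.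
Proof.
move=> a0 ab; rewrite !erf_ge0E// ?(le_trans a0 (ltW ab))//.
by rewrite ltr_pM2l// lt_integral0_gauss.
Qed.

Lemma erf_EFin_lt1 r : 0 <= r -> erf r%:E < 1.
Proof.
(* Passing to the limit only gives [erf (r + 1) <= 1]; strictness is gained between [r] and
   [r + 1]. *)
move=> r0; have r1 : r < r + 1 by rewrite ltrDl.
apply: (lt_le_trans (erf_EFin_lt r0 r1)).
apply: (cvgr_to_ge cvg_erf); near=> s.
apply/ltW/erf_EFin_lt; first exact: addr_ge0.
by near: s; apply: nbhs_pinfty_gt; exact: num_real.
Unshelve. all: end_near. Qed.

Lemma erf0 : erf 0%:E = 0 :> R.
Proof.
rewrite erf_ge0E// /gauss_integral_proof.integral0_gauss set_itv1.
by rewrite Rintegral_set1 mulr0.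
Qed.

(** Serves to rule out negative values of [erf_inv], which is defined by an arbitrary choice of
    preimage. *)
Lemma erf_lt0 (z : \bar R) : (z < 0)%E -> erf z < 0.
Proof.
case: z => [r| |]//; last by move=> _; rewrite /= ltrN10.
rewrite lte_fin => r0; rewrite /erf leNgt r0/= mulrN oppr_lt0 mulr_gt0//.
exact: Rintegral_gauss_fun_gt0.
Qed.

Lemma erf_lt (y z : \bar R) : (0 <= y)%E -> (y < z)%E -> erf y < erf z.
Proof.
case: y => [a| |]//; case: z => [b| |]//.
- by rewrite lee_fin lte_fin; exact: erf_EFin_lt.
- by rewrite lee_fin => a0 _; exact: erf_EFin_lt1.
Qed.

(** The value 1 comes from [+oo]. For [p < 1], the limit 1 at infinity yields an endpoint [b] with
    [p < erf b], and the intermediate value theorem applies on [[0, b]]. *)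
Lemma erf_surj p : 0 <= p <= 1 -> exists z, erf z = p.
Proof.
move=> /andP[p0]; rewrite le_eqVlt => /predU1P[->|p1]; first by exists +oo%E.
have [b [b0 pb]] : exists b, 0 <= b /\ p < erf b%:E.
  near (pinfty_nbhs R) => b; exists b; split=> //.
  near: b; exact: (cvgr_gt _ cvg_erf).
(* Continuity is shown for the formula valid on [[0, +oo[], free of the sign test in [erf]. *)
have erf_cont : {within `[0, b],
    continuous (fun r => 2 / Num.sqrt pi * gauss_int r)}.
  move=> r; apply: cvgMl_tmp; apply: parameterized_integral_continuous => //.
  exact: integrable_gauss_fun.
have [|r rb rp] := @IVT R _ 0 b p b0 erf_cont.
  have eb0 := le_trans p0 (ltW pb).
  by rewrite -!erf_ge0E// erf0 (min_l eb0) (max_r eb0) p0 ltW.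
by exists r%:E; rewrite erf_ge0E//; move: rb; rewrite in_itv/= => /andP[].
Unshelve. all: end_near. Qed.

(** A preimage exists by [erf_surj], so [xget] does not return its default value. *)
Lemma erf_invK p : 0 <= p <= 1 -> erf (erf_inv p) = p.
Proof.
by move=> /erf_surj[z zp]; rewrite /erf_inv; case: xgetP => // /(_ z).
Qed.

Lemma erf_inv_ge0 p : 0 <= p <= 1 -> (0 <= erf_inv p)%E.
Proof.
move=> p01; rewrite leNgt; apply/negP => /erf_lt0.
by rewrite erf_invK// ltNge; case/andP: p01 => ->.
Qed.

End erf_theory.

Lemma rho_SCBF_ge (R : realType) (gamma T alpha beta : R) :
  gamma <= 1 -> 0 <= T -> 0 <= beta -> gamma <= rho_SCBF gamma T alpha beta.
Proof.
move=> g1 T0 b0; have bT : 0 <= beta * T by rewrite mulr_ge0.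
have e1 : expR (- (beta * T)) <= 1 by rewrite -expR0 ler_expR oppr_le0.
have ege0 := expR_ge0 (- (beta * T)).
have E1 : gamma <= 1 - (1 - gamma) * expR (- (beta * T)) by nra.
rewrite /rho_SCBF; case: (ltP 0 alpha) => a0; last by rewrite lerDl.
case: (leP beta alpha) => // ab; apply: (le_trans E1).
have eV : expR (beta * T) * expR (- (beta * T)) = 1 by rewrite -expRD subrr expR0.
have E2 : 1 <= expR (beta * T) by rewrite -expR0 ler_expR.
have c1 : 1 <= beta / alpha by rewrite ler_pdivlMr// mul1r ltW.
(* With [beta / alpha] replaced by 1, the second formula of the bound equals the first one; since
   [1 <= beta / alpha], the actual value is at least as large. *)
rewrite [leLHS](_ : _ =
  (gamma + (expR (beta * T) - 1)) * expR (- (beta * T))); last first.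
  by rewrite !mulrDl eV; ring.
by rewrite ler_wpM2r// lerD2l ler_peMr// subr_ge0.
Qed.

(* True also in the degenerate cases, with the conventions 0^-1 = +oo,
   +oo^-1 = 0 and 0 * +oo = 0: the hypothesis is false for z = +oo or g = 0,
   and for h = 0 the right-hand side of the conclusion is +oo. *)
Lemma lte_div_swap (R : realType) (c T g : R) (h z : \bar R) :
  0 < c -> 0 < T -> 0 <= g -> (0 <= h)%E -> (0 <= z)%E ->
  (h < g%:E / ((c * T)%:E * z))%E -> (z < g%:E / (c%:E * h * T%:E))%E.
Proof.
move=> c0 T0 g0 h0; have cT0 : 0 < c * T by rewrite mulr_gt0.
case: z => [z| |]//; last first.
  by move=> _; rewrite gt0_muley ?lte_fin// invey mule0 (ltNge h) h0.
rewrite lee_fin -EFinM => z0.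
move: g0; rewrite le_eqVlt => /predU1P[<-|g0].
  by rewrite !mul0e (ltNge h) h0.
case: h h0 => [h| |]//; last by move=> _; rewrite (ltNge +oo%E) leey.
rewrite lee_fin le_eqVlt => /predU1P[<- _|h0].
  by rewrite mule0 mul0e inve0 gt0_muley ?lte_fin// ltry.
rewrite -!EFinM [X in _ -> (_ < _ * X)%E]inver gt_eqF ?mulr_gt0//.
(* For [z = 0] the hypothesis only reads [h < +oo], and the conclusion is the positivity of a finite
   quotient. *)
move: z0; rewrite le_eqVlt => /predU1P[<- _|z0].
  by rewrite -EFinM lte_fin divr_gt0// !mulr_gt0.
rewrite inver gt_eqF ?mulr_gt0// -!EFinM !lte_fin !ltr_pdivlMr ?mulr_gt0//.
by congr (_ < g); ring.
Qed.

Theorem theorem3 (R : realType) (n m q : nat)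
  (d : measure_display) (Omega : measurableType d) (P : probability Omega R)
  (P_complete : measure_is_complete P)
  (w : R -> Omega -> 'cV[R]_q) (w_wiener : standard_wiener P w)
  (X X0 : set 'cV[R]_n) (U : set 'cV[R]_m)
  (f : 'cV[R]_n -> 'cV[R]_n) (g : 'cV[R]_n -> 'M[R]_(n, m))
  (k : 'cV[R]_n -> 'cV[R]_m) (sigma : 'cV[R]_n -> 'M[R]_(n, q))
  (X_bounded : bounded_set X)
  (k_U : forall z, X z -> U (k z))
  (f_lip : locally_lipschitz X f) (f_bounded : [bounded f z | z in X])
  (g_lip : locally_lipschitz X g) (g_bounded : [bounded g z | z in X])
  (k_lip : locally_lipschitz X k) (k_bounded : [bounded k z | z in X])
  (sigma_lip : locally_lipschitz X sigma)
  (sigma_bounded : [bounded sigma z | z in X])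
  (x : 'cV[R]_n -> R -> Omega -> 'cV[R]_n)
  (x_sol : forall x0, X0 x0 -> strong_solution P w X f g k sigma x0 (x x0))
  (T : R) (T_gt0 : 0 < T)
  (B : 'cV[R]_n -> R) (B_C2 : C2 B) (B_psd : forall z, 0 <= B z)
  (gamma : R) (gamma_01 : 0 <= gamma <= 1)
  (B_X0 : forall z, X0 z -> B z <= gamma)
  (alpha beta : R) (B_SCBF : is_SCBF f g sigma B U alpha beta)
  (rho_d : R) (rho_d_adm : admissible_risks sigma B gamma T rho_d)
  (B_RACBF : is_RACBF f g k sigma B P U X0 x gamma T rho_d)
  (eta_small : (eta sigma B <
     (1 - gamma)%:E / ((Num.sqrt 2 * T)%:E * erf_inv (1 - gamma)))%E) :
  exists2 r : R,
    admissible_risks sigma B gamma T r /\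
    (forall r', admissible_risks sigma B gamma T r' -> r <= r')
  & r < rho_SCBF gamma T alpha beta.
Proof.
case/andP: gamma_01 => g0 g1.
have p01 : 0 <= 1 - gamma <= 1 by rewrite subr_ge0 g1 gerBl.
have [_ b0 _] := B_SCBF.
have eta0 : (0 <= eta sigma B)%E by rewrite /eta le_max lexx.
set arg := ((1 - gamma)%:E / ((Num.sqrt 2)%:E * eta sigma B * T%:E))%E.
have erf_arg : 1 - gamma < erf arg.
  rewrite -[ltLHS](erf_invK p01); apply: erf_lt; first exact: erf_inv_ge0.
  by apply: lte_div_swap; rewrite ?sqrtr_gt0 ?erf_inv_ge0//; case/andP: p01.
(* The minimum is the left endpoint; it belongs to the interval because [0 <= 1 - gamma < erf arg]
   keeps it below 1. *)
exists (1 - erf arg).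
  split=> [|r']; last by rewrite /admissible_risks/= in_itv/= => /andP[].
  rewrite /admissible_risks/= in_itv/= lexx gerBl.
  by apply: le_trans (ltW erf_arg); rewrite subr_ge0.
by apply: lt_le_trans (rho_SCBF_ge _ g1 (ltW T_gt0) b0); rewrite ltrBlDl -ltrBlDr.
Qed.
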